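(* The logics $L_\emptyset(\mathsf{H}_{12})$ and $L_\emptyset(\mathsf{E}_{10})$ are undecidable; that is, for each of them the set of sentences true in all models (equivalently, the set of satisfiable sentences) is not recursive.
   Context: A Henkin (branching) quantifier prefix is a triple $Q=(A,E,D)$ where $A=\{x_1,\dots,x_n\}$ and $E=\{y_1,\dots,y_k\}$ are disjoint sets of universal and existential variables and $D\subseteq A\times E$ is a dependency relation ($y$ depends on $x$ iff $(x,y)\in D$). Semantics: $M\models Q\varphi(\bar x,\bar y)$ iff there are functions $f_1,\dots,f_k$ on the universe of $M$ such that $(M,f_1,\dots,f_k)\models \forall \bar x\,\varphi(\bar x,f_1(\bar x_1),\dots,f_k(\bar x_k))$, where $\bar x$ lists all universal variables of $Q$ and $\bar x_i$ lists the universal variables on which $y_i$ depends. $L_\emptyset(Q)$ is first-order logic with equality over the empty vocabulary (the only atomic formulas are equalities between variables) extended by the quantifier $Q$. $\mathsf{H}_n$ is the quantifier with universal variables $x_1,\dots,x_n$, existential variables $y_1,\dots,y_n$, where each $y_i$ depends only on $x_i$. $\mathsf{E}_n$ is the quantifier with universal variables $x_1,x_2$ and existential variables $y_1,\dots,y_n,z_1,\dots,z_n$, where each $y_i$ depends only on $x_1$ and each $z_i$ depends only on $x_2$. *)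

(* Defs.v *)
From Stdlib Require Import Arith List Cantor.
Import ListNotations.

Inductive recfun : Type :=
| RZero : recfun
| RSucc : recfun
| RProj : nat -> recfun
| RComp : recfun -> list recfun -> recfun
| RPrec : recfun -> recfun -> recfun
| RMu   : recfun -> recfun.

Inductive eval : recfun -> list nat -> nat -> Prop :=
| ev_zero v : eval RZero v 0
| ev_succ x v : eval RSucc (x :: v) (S x)
| ev_proj i v : i < length v -> eval (RProj i) v (nth i v 0)
| ev_comp f gs v ws y :
    Forall2 (fun g w => eval g v w) gs ws -> eval f ws y -> eval (RComp f gs) v y
| ev_prec0 f g v y : eval f v y -> eval (RPrec f g) (0 :: v) y
| ev_precS f g n v y z :
    eval (RPrec f g) (n :: v) y -> eval g (n :: y :: v) z ->
    eval (RPrec f g) (S n :: v) z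
| ev_mu f v n :
    eval f (n :: v) 0 ->
    (forall m, m < n -> exists k, eval f (m :: v) (S k)) ->
    eval (RMu f) v n.

(* Universal variables are indexed 0..hA-1, existential ones 0..hE-1;  *)
(* hD j i = true iff the i-th existential depends on the j-th universal *)

Record henkin := { hA : nat; hE : nat; hD : nat -> nat -> bool }.

Definition Hq (n : nat) : henkin :=
  {| hA := n; hE := n; hD := fun j i => Nat.eqb j i |}.

(* E_n : x_1, x_2; existentials y_1..y_n (indices 0..n-1) depending only on
   x_1 (index 0), and z_1..z_n (indices n..2n-1) depending only on x_2
   (index 1). *)
Definition Eq_ (n : nat) : henkin :=
  {| hA := 2; hE := 2 * n;
     hD := fun j i => if i <? n then Nat.eqb j 0 else Nat.eqb j 1 |}.

Inductive form : Type :=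
| FEq  : nat -> nat -> form
| FNeg : form -> form
| FAnd : form -> form -> form
| FEx  : nat -> form -> form
| FQ   : list nat -> list nat -> form -> form.

Fixpoint wf (Q : henkin) (phi : form) : Prop :=
  match phi with
  | FEq _ _ => True
  | FNeg p => wf Q p
  | FAnd p q => wf Q p /\ wf Q q
  | FEx _ p => wf Q p
  | FQ xs ys p => length xs = hA Q /\ length ys = hE Q /\ NoDup (xs ++ ys) /\ wf Q p
  end.

Fixpoint free_in (v : nat) (phi : form) : Prop :=
  match phi with
  | FEq a b => v = a \/ v = b
  | FNeg p => free_in v p
  | FAnd p q => free_in v p \/ free_in v q
  | FEx x p => v <> x /\ free_in v p
  | FQ xs ys p => ~ In v xs /\ ~ In v ys /\ free_in v p
  end.

Definition sentence (Q : henkin) (phi : form) : Prop :=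
  wf Q phi /\ forall v, ~ free_in v phi.

(* Semantics. A model over the empty vocabulary is a nonempty type M.  *)

Definition upd {M : Type} (e : nat -> M) (x : nat) (m : M) : nat -> M :=
  fun v => if Nat.eqb v x then m else e v.

Fixpoint index_of (v : nat) (l : list nat) : option nat :=
  match l with
  | [] => None
  | x :: l' => if Nat.eqb v x then Some 0
               else match index_of v l' with Some k => Some (S k) | None => None end
  end.

Definition updl {M : Type} (e : nat -> M) (xs : list nat) (a : nat -> M) : nat -> M :=
  fun v => match index_of v xs with Some j => a j | None => e v end.

Fixpoint sat (Q : henkin) {M : Type} (e : nat -> M) (phi : form) : Prop :=
  match phi with
  | FEq a b => e a = e b
  | FNeg p => ~ sat Q e p
  | FAnd p q => sat Q e p /\ sat Q e q
  | FEx x p => exists m : M, sat Q (upd e x m) p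
  | FQ xs ys p =>
      exists f : nat -> (nat -> M) -> M,
        (forall i (a a' : nat -> M),
            (forall j, j < hA Q -> hD Q j i = true -> a j = a' j) ->
            f i a = f i a') /\
        (forall a : nat -> M, sat Q (updl (updl e xs a) ys (fun i => f i a)) p)
  end.

Definition valid (Q : henkin) (phi : form) : Prop :=
  forall (M : Type) (m0 : M) (e : nat -> M), sat Q e phi.

Definition satisfiable (Q : henkin) (phi : form) : Prop :=
  exists (M : Type) (m0 : M) (e : nat -> M), sat Q e phi.

Definition pair (x y : nat) : nat := Cantor.to_nat (x, y).

Fixpoint code_list (l : list nat) : nat :=
  match l with [] => 0 | x :: l' => S (pair x (code_list l')) end.

Fixpoint code (phi : form) : nat :=
  match phi with
  | FEq a b => pair 0 (pair a b)
  | FNeg p => pair 1 (code p)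
  | FAnd p q => pair 2 (pair (code p) (code q))
  | FEx x p => pair 3 (pair x (code p))
  | FQ xs ys p => pair 4 (pair (code_list xs) (pair (code_list ys) (code p)))
  end.

Definition recursive_on (W P : form -> Prop) : Prop :=
  exists f : recfun, forall phi, W phi ->
    (P phi -> eval f [code phi] 0) /\ (~ P phi -> eval f [code phi] 1).

(* Main.v *)
Require Import Defs.
From Stdlib Require Import Arith List Lia Cantor Classical ClassicalEpsilon.
Import ListNotations.

(* Existential variables of either prefix are used as six unary function variables seen at
   two points: "there are F_0, ..., F_5 such that for all x, x' a quantifier-free condition
   holds of x, x', F_i(x), F_i(x')".  Existentially quantified individuals in front of the
   prefix serve as constants, so a whole finite program fits into the condition.  A partial
   recursive function P is turned into finitely many equations between total unary functions
   on codes of tuples; all these functions live in the single function F_4 by letting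
   the elements of the model be pairs (label, argument).  In every model the equations force
   the value of P wherever P is defined, while the equations always have a solution over the
   natural numbers, with an arbitrary value at divergent arguments.  Hence, for
   defined P(n), the sentence "the equations hold and P(n) is not 0" is satisfiable iff P(n)
   is not 0.  The numeral n enters as a chain of constants; taking n to be the code
   of the part of the sentence that describes P makes the sentence refer to itself, so a
   decision procedure for satisfiability, composed with the coding of the sentence, serves as
   a P that contradicts itself. *)

(** * Computability of the coding *)

Definition computable (k : nat) (h : list nat -> nat) : Prop :=
  exists r, forall v, length v = k -> eval r v (h v).

Lemma computable_ext k h h' :
  (forall v, length v = k -> h v = h' v) -> computable k h -> computable k h'.
Proof.
  intros E [r Hr]. exists r. intros v Hv. rewrite <- E by exact Hv. auto.
Qed.

Lemma computable_nth k i : i < k -> computable k (fun v => nth i v 0).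
Proof.
  intros Hi. exists (RProj i). intros v Hv. constructor. lia.
Qed.

Lemma computable_succ k h : computable k h -> computable k (fun v => S (h v)).
Proof.
  intros [r Hr]. exists (RComp RSucc [r]). intros v Hv.
  econstructor; [repeat constructor; apply Hr, Hv | constructor].
Qed.

Lemma computable_const k c : computable k (fun _ => c).
Proof.
  induction c as [|c IH].
  - exists RZero. intros. constructor.
  - apply computable_succ, IH.
Qed.

Lemma computable_comp1 k h g :
  computable 1 (fun v => h (nth 0 v 0)) -> computable k g ->
  computable k (fun v => h (g v)).
Proof.
  intros [r Hr] [s Hs]. exists (RComp r [s]). intros v Hv.
  econstructor; [repeat constructor; apply Hs, Hv | apply (Hr [g v] eq_refl)].
Qed.

Lemma computable_comp2 k (h : nat -> nat -> nat) g1 g2 :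
  computable 2 (fun v => h (nth 0 v 0) (nth 1 v 0)) ->
  computable k g1 -> computable k g2 ->
  computable k (fun v => h (g1 v) (g2 v)).
Proof.
  intros [r Hr] [s1 H1] [s2 H2]. exists (RComp r [s1; s2]). intros v Hv.
  econstructor; [repeat constructor; [apply H1, Hv | apply H2, Hv]
                | apply (Hr [g1 v; g2 v] eq_refl)].
Qed.

Lemma computable_prec k f g :
  computable k f -> computable (S (S k)) g ->
  computable (S k) (fun v => nat_rect (fun _ => nat) (f (tl v))
                               (fun n y => g (n :: y :: tl v)) (hd 0 v)).
Proof.
  intros [r Hr] [s Hs]. exists (RPrec r s). intros [|n v] Hv; [discriminate|].
  injection Hv as Hv. cbn [hd tl]. induction n as [|n IH]; cbn [nat_rect].
  - constructor. auto.
  - econstructor; [exact IH|]. apply Hs. cbn. lia.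
Qed.

Lemma computable_add k f g :
  computable k f -> computable k g -> computable k (fun v => f v + g v).
Proof.
  apply (computable_comp2 k Nat.add).
  eapply computable_ext;
    [|apply (computable_prec 1 (fun v => nth 0 v 0) (fun v => S (nth 1 v 0)))].
  - intros [|n [|x [|]]] Hv; try discriminate. cbn [nth hd tl].
    induction n as [|n IH]; cbn in *; lia.
  - apply computable_nth. lia.
  - apply computable_succ, computable_nth. lia.
Qed.

Lemma computable_pair k f g :
  computable k f -> computable k g -> computable k (fun v => pair (f v) (g v)).
Proof.
  apply (computable_comp2 k pair).
  (* The Cantor code of (x, y) is by definition y plus the triangular number of y + x, written here
     with the same recursion so that [reflexivity] identifies the two. *)
  eapply computable_ext with
    (h := fun v => nth 1 v 0 + (fun n => nat_rec (fun _ => nat) 0 (fun i m => S i + m) n)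
                                 (nth 1 v 0 + nth 0 v 0)).
  - reflexivity.
  - apply computable_add; [apply computable_nth; lia|].
    apply computable_comp1.
    + eapply computable_ext;
        [|apply (computable_prec 0 (fun _ => 0) (fun v => S (nth 0 v 0) + nth 1 v 0))].
      * intros [|n [|]] Hv; try discriminate. reflexivity.
      * apply computable_const.
      * apply computable_add; [apply computable_succ|]; apply computable_nth; lia.
    + apply computable_add; apply computable_nth; lia.
Qed.

Lemma pair_le x y : x <= pair x y /\ y <= pair x y.
Proof.
  unfold pair. pose proof (to_nat_non_decreasing x y). lia.
Qed.

Lemma pair_inj x y x' y' : pair x y = pair x' y' -> x = x' /\ y = y'.
Proof.
  unfold pair. intros H. apply to_nat_inj in H. injection H. auto.
Qed.

Definition pfst (p : nat) : nat := fst (Cantor.of_nat p).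
Definition psnd (p : nat) : nat := snd (Cantor.of_nat p).

Lemma pfst_pair x y : pfst (pair x y) = x.
Proof. unfold pfst, pair. now rewrite Cantor.cancel_of_to. Qed.

Lemma psnd_pair x y : psnd (pair x y) = y.
Proof. unfold psnd, pair. now rewrite Cantor.cancel_of_to. Qed.

Lemma pair_eta p : pair (pfst p) (psnd p) = p.
Proof.
  unfold pfst, psnd, pair. rewrite <- surjective_pairing. apply Cantor.cancel_to_of.
Qed.

#[local] Opaque pair.

(** * Derived connectives and closure of formulas into sentences *)

Definition imp (p q : form) : form := FNeg (FAnd p (FNeg q)).

Fixpoint exs (n : nat) (p : form) : form :=
  match n with 0 => p | S k => FEx k (exs k p) end.

(** A code bounds every variable free in its formula, so binding all variables up to the code needs
    no list of free variables and stays computable from the code alone. *)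
Definition close (p : form) : form := exs (S (code p)) p.

Lemma free_in_le_code v p : free_in v p -> v <= code p.
Proof.
  induction p as [a b|p IH|p IHp q IHq|x p IH|xs ys p IH]; cbn; intros H.
  - pose proof (pair_le 0 (pair a b)). pose proof (pair_le a b). lia.
  - pose proof (pair_le 1 (code p)). specialize (IH H). lia.
  - pose proof (pair_le 2 (pair (code p) (code q))).
    pose proof (pair_le (code p) (code q)). destruct H as [H|H]; [apply IHp in H|apply IHq in H]; lia.
  - pose proof (pair_le 3 (pair x (code p))). pose proof (pair_le x (code p)).
    apply proj2, IH in H. lia.
  - pose proof (pair_le 4 (pair (code_list xs) (pair (code_list ys) (code p)))).
    pose proof (pair_le (code_list xs) (pair (code_list ys) (code p))).
    pose proof (pair_le (code_list ys) (code p)). destruct H as (_ & _ & H%IH). lia.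
Qed.

Lemma free_in_exs v n p : free_in v (exs n p) -> free_in v p /\ n <= v.
Proof.
  induction n as [|k IH]; cbn; intros H; [split; [exact H|lia]|].
  destruct H as [Hne H]. apply IH in H. split; [apply H|lia].
Qed.

Lemma wf_exs Q n p : wf Q p -> wf Q (exs n p).
Proof. induction n; cbn; auto. Qed.

Lemma sentence_close Q p : wf Q p -> sentence Q (close p).
Proof.
  intros H. split; [apply wf_exs, H|]. intros v Hv. unfold close in Hv.
  apply free_in_exs in Hv as [Hv Hle]. apply free_in_le_code in Hv. lia.
Qed.

Lemma upd_self {M} (e : nat -> M) x : forall v, upd e x (e x) v = e v.
Proof.
  intros v. unfold upd. destruct (Nat.eqb_spec v x); congruence.
Qed.

Lemma sat_ext Q M (p : form) : forall e e' : nat -> M,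
  (forall v, e v = e' v) -> sat Q e p -> sat Q e' p.
Proof.
  induction p as [a b|p IH|p IHp q IHq|x p IH|xs ys p IH]; cbn; intros e e' E.
  - rewrite !E. auto.
  - intros H H'. apply H. revert H'. apply IH. auto.
  - intros [H1 H2]. eauto.
  - intros [m H]. exists m. revert H. apply IH. intros v. unfold upd.
    destruct (v =? x); auto.
  - intros [f [Hf H]]. exists f. split; [exact Hf|]. intros a. generalize (H a). apply IH.
    intros v. unfold updl. destruct (index_of v ys); [auto|]. destruct (index_of v xs); auto.
Qed.

Lemma sat_exs_intro Q M (e : nat -> M) n p : sat Q e p -> sat Q e (exs n p).
Proof.
  intros H. induction n as [|k IH]; cbn; [exact H|]. exists (e k).
  revert IH. apply sat_ext. intros v. symmetry. apply upd_self.
Qed.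

Lemma sat_exs_elim Q M n p : forall e : nat -> M,
  sat Q e (exs n p) -> exists e' : nat -> M, sat Q e' p.
Proof.
  induction n as [|k IH]; cbn; intros e H; [eauto|]. destruct H as [m H]. eapply IH, H.
Qed.

Lemma sat_imp Q M (e : nat -> M) p q : sat Q e (imp p q) <-> (sat Q e p -> sat Q e q).
Proof.
  cbn. split; [intros H Hp; apply NNPP; tauto | tauto].
Qed.

Fixpoint conjs (l : list form) : form :=
  match l with [] => FEq 0 0 | p :: l' => FAnd p (conjs l') end.

Definition rule (hs : list form) (p : form) : form := imp (conjs hs) p.

Lemma sat_conjs Q M (e : nat -> M) l :
  sat Q e (conjs l) <-> forall p, In p l -> sat Q e p.
Proof.
  induction l as [|q l IH]; cbn; [split; [tauto | reflexivity]|]. rewrite IH.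
  split; [intros [H1 H2] p [<-|H]; auto | intros H; split; auto].
Qed.

Lemma wf_conjs Q l : (forall p, In p l -> wf Q p) -> wf Q (conjs l).
Proof. induction l; cbn; auto. Qed.

(** * Formula operations that are computable on codes *)

Definition codable (G : form -> form) : Prop :=
  exists h, computable 1 h /\ forall B, h [code B] = code (G B).

Lemma codable_const p : codable (fun _ => p).
Proof. exists (fun _ => code p). split; [apply computable_const | reflexivity]. Qed.

Lemma codable_id : codable (fun B => B).
Proof. exists (fun v => nth 0 v 0). split; [apply computable_nth; lia | reflexivity]. Qed.

Lemma codable_FNeg G : codable G -> codable (fun B => FNeg (G B)).
Proof.
  intros [h [Hh E]]. exists (fun v => pair 1 (h v)). split.
  - apply computable_pair; [apply computable_const | exact Hh].
  - intros B. cbn. now rewrite E.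
Qed.

Lemma codable_FAnd G1 G2 : codable G1 -> codable G2 -> codable (fun B => FAnd (G1 B) (G2 B)).
Proof.
  intros [h1 [H1 E1]] [h2 [H2 E2]]. exists (fun v => pair 2 (pair (h1 v) (h2 v))). split.
  - repeat apply computable_pair; auto using computable_const.
  - intros B. cbn. now rewrite E1, E2.
Qed.

Lemma codable_FQ xs ys G : codable G -> codable (fun B => FQ xs ys (G B)).
Proof.
  intros [h [Hh E]].
  exists (fun v => pair 4 (pair (code_list xs) (pair (code_list ys) (h v)))). split.
  - repeat apply computable_pair; auto using computable_const.
  - intros B. cbn. now rewrite E.
Qed.

Lemma codable_close G : codable G -> codable (fun B => close (G B)).
Proof.
  intros [h [Hh E]].
  exists (fun v => nat_rect (fun _ => nat) (h v) (fun n y => pair 3 (pair n y)) (S (h v))).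
  split.
  - apply (computable_comp2 1
      (fun n c => nat_rect (fun _ => nat) c (fun n y => pair 3 (pair n y)) n)
      (fun v => S (h v)) h); [|apply computable_succ, Hh | exact Hh].
    eapply computable_ext;
      [|apply (computable_prec 1 (fun v => nth 0 v 0)
                 (fun v => pair 3 (pair (nth 0 v 0) (nth 1 v 0))))].
    + intros [|n [|x [|]]] Hv; try discriminate. reflexivity.
    + apply computable_nth. lia.
    + repeat apply computable_pair; try apply computable_const; apply computable_nth; lia.
  - intros B. rewrite E. unfold close. generalize (S (code (G B))).
    induction n as [|n IH]; cbn; [reflexivity | now rewrite IH].
Qed.

(* Variables 0 to 23 belong to the prefix: [pt1], [pt2] are the two points, [fn1 i], [fn2 i]
   the values of the [i]-th function there. The constants are the variables from 24 on. *)
Definition cst (i : nat) : nat := 24 + i.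
Definition fn1 (i : nat) : nat := 12 + i.
Definition fn2 (i : nat) : nat := 18 + i.
Definition pt1 : nat := 0.
Definition pt2 : nat := 6.

(** Required at every first point, with slot 0 as successor, this makes [cst 0], ..., [cst n]
    consecutive, so that [cst n] denotes the numeral n. *)
Fixpoint chain (n : nat) : form :=
  match n with
  | 0 => FEq 0 0
  | S k => FAnd (imp (FEq pt1 (cst k)) (FEq (fn1 0) (cst (S k)))) (chain k)
  end.

Lemma codable_chain : codable (fun B => chain (code B)).
Proof.
  exists (fun v => nat_rect (fun _ => nat) (code (FEq 0 0)) (fun k y =>
    pair 2 (pair (pair 1 (pair 2 (pair (pair 0 (pair pt1 (cst k)))
       (pair 1 (pair 0 (pair (fn1 0) (cst (S k)))))))) y)) (hd 0 v)).
  split.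
  - eapply (computable_prec 0 (fun _ => code (FEq 0 0)) (fun v => pair 2 (pair (pair 1 (pair 2
       (pair (pair 0 (pair pt1 (cst (nth 0 v 0))))
       (pair 1 (pair 0 (pair (fn1 0) (cst (S (nth 0 v 0))))))))) (nth 1 v 0)))).
    + apply computable_const.
    + unfold cst.
      repeat first [apply computable_pair | apply computable_const | apply computable_add
                   | apply computable_succ | apply computable_nth; lia].
  - intros B. cbn [hd]. generalize (code B). 
    induction n as [|n IH]; [reflexivity|]. cbn [nat_rect]. rewrite IH. reflexivity.
Qed.

Lemma codable_eq_const v : codable (fun B => FEq v (cst (code B))).
Proof.
  exists (fun u => pair 0 (pair v (cst (nth 0 u 0)))). split; [|reflexivity].
  unfold cst.
  repeat first [apply computable_pair | apply computable_const | apply computable_add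
               | apply computable_nth; lia].
Qed.

(** * Equations between unary functions *)

(** Terms for unary functions, tuples being passed as nested pairs. [UInput] is the constant
    function holding the input numeral. *)
Inductive ufun : Type :=
| UId | USucc | UPred | UZero | UInput | UFst | USnd
| UComp (a b : ufun)
| UPair (a b : ufun)
| UIf (c a b : ufun)
| UPrec (f g : ufun)
| USearch (f : ufun).

(** Right-hand sides of the recursion laws for primitive recursion and search, unfolded once. The
    argument codes a pair (n, w) of a counter and the remaining tuple. *)
Definition prec_body (f g : ufun) : ufun :=
  UIf UFst (UComp f USnd)
    (UComp g (UPair (UComp UPred UFst)
                (UPair (UComp (UPrec f g) (UPair (UComp UPred UFst) USnd)) USnd))).

Definition search_body (f : ufun) : ufun :=
  UIf f UFst (UComp (USearch f) (UPair (UComp USucc UFst) USnd)).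

(** The terms that the equation of [t] mentions. A pair brings in its composites with [UFst] and
    [USnd], because the projection laws are stated as agreement of these composites with the
    components. *)
Definition deps (t : ufun) : list ufun :=
  match t with
  | UComp a b => [a; b]
  | UPair a b => [UComp UFst t; UComp USnd t; a; b]
  | UIf c a b => [c; a; b]
  | UPrec f g => [prec_body f g]
  | USearch f => [search_body f]
  | _ => []
  end.

Definition dep_closed (T : ufun -> Prop) : Prop :=
  forall t u, T t -> In u (deps t) -> T u.

Lemma dep_closed_app l m :
  dep_closed (fun t => In t l) -> dep_closed (fun t => In t m) ->
  dep_closed (fun t => In t (l ++ m)).
Proof.
  intros Hl Hm t u Ht Hu. apply in_or_app.
  apply in_app_or in Ht as [Ht|Ht]; [left; eapply Hl | right; eapply Hm]; eauto.
Qed.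

Lemma dep_closed_extend l m :
  Forall (fun t => Forall (fun u => In u (l ++ m)) (deps t)) l ->
  dep_closed (fun t => In t m) -> dep_closed (fun t => In t (l ++ m)).
Proof.
  intros Hl Hm t u Ht Hu. apply in_app_or in Ht as [Ht|Ht].
  - rewrite Forall_forall in Hl. specialize (Hl t Ht). rewrite Forall_forall in Hl. auto.
  - apply in_or_app. right. eapply Hm; eauto.
Qed.

Lemma dep_closed_nil : dep_closed (fun t => In t []).
Proof. intros t u []. Qed.

Ltac explicit_deps :=
  repeat (apply Forall_cons || apply Forall_nil);
  cbn [deps prec_body search_body];
  repeat (apply Forall_cons || apply Forall_nil);
  rewrite ?in_app_iff; cbn [In]; tauto.

(** The unfolded laws of [UPrec] and [USearch] mention the same term again, so unfolding runs in a
    circle: a fixed list of composites, added to the closures of the subterms, is closed. *)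
Lemma finite_dep_closure t :
  exists l, In t l /\ dep_closed (fun u => In u l).
Proof.
  induction t as [| | | | | | |a [la [Ha Ca]] b [lb [Hb Cb]]|a [la [Ha Ca]] b [lb [Hb Cb]]
    |c [lc [Hc Cc]] a [la [Ha Ca]] b [lb [Hb Cb]]|f [lf [Hf Cf]] g [lg [Hg Cg]]|f [lf [Hf Cf]]].
  1-7: match goal with |- exists l, In ?t l /\ _ => exists ([t] ++ []) end;
    split; [now left | apply dep_closed_extend; [repeat constructor | apply dep_closed_nil]].
  - exists ([UComp a b] ++ la ++ lb). split; [now left|].
    apply dep_closed_extend; [explicit_deps|auto using dep_closed_app].
  - exists ([UPair a b; UComp UFst (UPair a b); UComp USnd (UPair a b); UFst; USnd] ++ la ++ lb).
    split; [now left|].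
    apply dep_closed_extend; [explicit_deps|auto using dep_closed_app].
  - exists ([UIf c a b] ++ lc ++ la ++ lb). split; [now left|].
    apply dep_closed_extend; [explicit_deps|auto using dep_closed_app].
  - set (X := UPair (UComp UPred UFst) USnd).
    set (Y2 := UPair (UComp (UPrec f g) X) USnd).
    set (Y := UPair (UComp UPred UFst) Y2).
    exists ([UPrec f g; prec_body f g; UFst; USnd; UComp f USnd; UComp g Y; UComp UPred UFst; UPred;
             UComp (UPrec f g) X; X; UComp UFst X; UComp USnd X; Y2; UComp UFst Y2; UComp USnd Y2;
             Y; UComp UFst Y; UComp USnd Y] ++ lf ++ lg).
    split; [now left|]. subst Y Y2 X.
    apply dep_closed_extend; [explicit_deps|auto using dep_closed_app].
  - set (X := UPair (UComp USucc UFst) USnd).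
    exists ([USearch f; search_body f; UFst; USnd; UComp USucc UFst; USucc; UComp (USearch f) X;
             X; UComp UFst X; UComp USnd X] ++ lf).
    split; [now left|]. subst X.
    apply dep_closed_extend; [explicit_deps|auto].
Qed.

(* No function is required to be determined off the numbers [N], and pairing need not be
   injective: only the equations of the labels in [T] are imposed. *)
Record eq_model (T : ufun -> Prop) (M : Type) (N : M -> Prop) (z : M) (s : M -> M)
    (G : ufun -> M -> M) : Prop := {
  em_zero : N z;
  em_succ : forall n, N n -> N (s n);
  em_app : forall t n, T t -> N n -> N (G t n);
  em_succ_neq : forall n, s n <> z;
  em_UId : forall n, T UId -> N n -> G UId n = n;
  em_USucc : forall n, T USucc -> N n -> G USucc n = s n;
  em_UPred : forall n, T UPred -> N n -> G UPred (s n) = n;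
  em_UZero : forall n, T UZero -> N n -> G UZero n = z;
  em_UComp : forall a b n, T (UComp a b) -> N n -> G (UComp a b) n = G a (G b n);
  em_UFst : forall a b n, T (UPair a b) -> N n -> G UFst (G (UPair a b) n) = G a n;
  em_USnd : forall a b n, T (UPair a b) -> N n -> G USnd (G (UPair a b) n) = G b n;
  em_UIf0 : forall c a b n, T (UIf c a b) -> N n -> G c n = z -> G (UIf c a b) n = G a n;
  em_UIf1 : forall c a b n, T (UIf c a b) -> N n -> G c n <> z -> G (UIf c a b) n = G b n;
  em_UPrec : forall f g n, T (UPrec f g) -> N n -> G (UPrec f g) n = G (prec_body f g) n;
  em_USearch : forall f n, T (USearch f) -> N n -> G (USearch f) n = G (search_body f) n
}.

(** * Compiling partial recursive functions into unary functions *)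

Fixpoint uproj (i : nat) : ufun :=
  match i with 0 => UFst | S k => UComp (uproj k) USnd end.

Fixpoint compile (f : recfun) : ufun :=
  match f with
  | RZero => UZero
  | RSucc => UComp USucc UFst
  | RProj i => uproj i
  | RComp f gs => UComp (compile f) (fold_right (fun g t => UPair (compile g) t) UZero gs)
  | RPrec f g => UPrec (compile f) (compile g)
  | RMu f => UComp (USearch (compile f)) (UPair UZero UId)
  end.

Fixpoint recfun_nested_ind (P : recfun -> Prop)
  (HZ : P RZero) (HS : P RSucc) (HP : forall i, P (RProj i))
  (HC : forall f gs, P f -> Forall P gs -> P (RComp f gs))
  (HR : forall f g, P f -> P g -> P (RPrec f g))
  (HM : forall f, P f -> P (RMu f)) (f : recfun) : P f :=
  let rec := recfun_nested_ind P HZ HS HP HC HR HM in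
  match f with
  | RZero => HZ
  | RSucc => HS
  | RProj i => HP i
  | RComp f gs => HC f gs (rec f)
      ((fix all l := match l return Forall P l with
                     | [] => Forall_nil P
                     | g :: l' => Forall_cons g (rec g) (all l')
                     end) gs)
  | RPrec f g => HR f g (rec f) (rec g)
  | RMu f => HM f (rec f)
  end.

(** Only the leading entries of the tuple coded by [p] are fixed; the tail after them is
    arbitrary. *)
Fixpoint represents {M} (z : M) (s : M -> M) (G : ufun -> M -> M) (p : M) (v : list nat) : Prop :=
  match v with
  | [] => True
  | a :: v' => G UFst p = Nat.iter a s z /\ represents z s G (G USnd p) v'
  end.

(** Each round adds one missing dependency to the context. When none is missing, the match on the
    empty list fails, which ends the loop. *)
Ltac deps_in T HT :=
  repeat match goal with
  | H : T ?t |- _ =>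
      let l := eval cbn [deps prec_body search_body] in (deps t) in
      let rec go l :=
        lazymatch l with
        | ?u :: ?l' =>
            lazymatch goal with
            | _ : T u |- _ => go l'
            | _ => assert (T u) by (apply (HT _ u H); cbn [deps prec_body search_body In]; tauto)
            end
        end
      in go l
  end.

(** The equations are applied only along the terminating computation given by [eval], so they force
    its value in every model. The induction follows the program, with inner inductions on the
    recursion counter and on the length of the search. *)
Lemma compile_correct T M N z s G :
  eq_model T M N z s G -> dep_closed T ->
  forall f v y, eval f v y ->
  forall p, T (compile f) -> N p -> represents z s G p v ->
  G (compile f) p = Nat.iter y s z.
Proof.
  intros E HT.
  assert (Nnum : forall n, N (Nat.iter n s z))
    by (induction n; cbn; [apply (em_zero _ _ _ _ _ _ E) | apply (em_succ _ _ _ _ _ _ E); auto]).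
  assert (Napp := em_app _ _ _ _ _ _ E).
  assert (Ecomp := em_UComp _ _ _ _ _ _ E).
  assert (Efst := em_UFst _ _ _ _ _ _ E).
  assert (Esnd := em_USnd _ _ _ _ _ _ E).
  induction f as [| |i|f gs IHf IHgs|f g IHf IHg|f IHf] using recfun_nested_ind;
    intros v y He; cbn [compile].
  - inversion He; subst. intros p Tf Np Hp. now rewrite (em_UZero _ _ _ _ _ _ E).
  - inversion He; subst. intros p Tf Np [Hp _]. deps_in T HT. rewrite Ecomp, Hp by auto.
    now rewrite (em_USucc _ _ _ _ _ _ E).
  - inversion He as [| |i' v' Hi| | | |]; subst. clear He. revert v Hi.
    induction i as [|i IH]; intros v Hi p Tf Np Hp.
    + destruct v as [|a v]; cbn in Hi; [lia|]. apply Hp.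
    + destruct v as [|a v]; cbn in Hi; [lia|]. cbn [uproj nth] in *.
      deps_in T HT. rewrite Ecomp by auto. apply IH; auto; [lia|]. apply Hp.
  - inversion He as [| | |f' gs' v' ws y' Hgs Hf| | |]; subst. intros p Tf Np Hp.
    deps_in T HT. rewrite Ecomp by auto. apply (IHf ws y Hf); auto.
    clear Tf Hf He. revert ws Hgs.
    induction IHgs as [|g gs Hg _ IH]; intros ws H2; inversion H2; subst; [exact I|].
    cbn [fold_right represents] in *. deps_in T HT. rewrite Efst, Esnd by auto.
    split; [eapply Hg; eauto | auto].
  - assert (Hv : exists n w, v = n :: w) by (inversion He; eauto).
    destruct Hv as (n & w & ->). revert y He.
    induction n as [|n IH]; intros y He p Tf Np [H1 H2]; inversion He; subst;
      deps_in T HT; rewrite (em_UPrec _ _ _ _ _ _ E) by auto; unfold prec_body.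
    + rewrite (em_UIf0 _ _ _ _ _ _ E), Ecomp by auto. eapply IHf; eauto.
    + rewrite (em_UIf1 _ _ _ _ _ _ E), Ecomp; auto;
        [|rewrite H1; apply (em_succ_neq _ _ _ _ _ _ E)].
      assert (Hpred : G (UComp UPred UFst) p = Nat.iter n s z).
      { rewrite Ecomp, H1 by auto. change (Nat.iter (S n) s z) with (s (Nat.iter n s z)).
        rewrite (em_UPred _ _ _ _ _ _ E); auto. }
      eapply IHg; eauto. cbn [represents].
      rewrite !Efst, !Esnd by auto. repeat split; [exact Hpred| |].
      * rewrite !Efst by auto. rewrite Ecomp by auto. eapply IH; eauto. cbn [represents].
        rewrite Efst, Esnd by auto. auto.
      * exact H2.
  - inversion He as [| | | | | |f' v' n Hz Hlt]; subst. intros p Tf Np Hp. deps_in T HT.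
    rewrite Ecomp by auto.
    (* Here [d] is the distance from the current counter up to the least zero [y]. *)
    assert (Hs : forall d q, d <= y -> N q -> represents z s G q (y - d :: v) ->
                 G (USearch (compile f)) q = Nat.iter y s z).
    { induction d as [|d IH]; intros q Hd Nq Hq; rewrite (em_USearch _ _ _ _ _ _ E) by auto;
        unfold search_body.
      - rewrite Nat.sub_0_r in Hq. rewrite (em_UIf0 _ _ _ _ _ _ E); auto; [apply Hq|].
        apply (IHf _ _ Hz); auto.
      - destruct (Hlt (y - S d)) as [k Hk]; [lia|].
        rewrite (em_UIf1 _ _ _ _ _ _ E); auto.
        + rewrite Ecomp by auto. apply IH; [lia|auto|]. cbn [represents].
          rewrite Efst, Esnd by auto. destruct Hq as [Hq Hr]. split; [|exact Hr].
          rewrite Ecomp, Hq by auto. rewrite (em_USucc _ _ _ _ _ _ E) by auto.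
          replace (y - d) with (S (y - S d)) by lia. reflexivity.
        + rewrite (IHf _ _ Hk) by auto. cbn. apply (em_succ_neq _ _ _ _ _ _ E). }
    apply (Hs y); auto. rewrite Nat.sub_diag. cbn [represents]. rewrite Efst, Esnd by auto.
    rewrite (em_UZero _ _ _ _ _ _ E), (em_UId _ _ _ _ _ _ E) by auto. split; [reflexivity|exact Hp].
Qed.

(** * The standard solution over the natural numbers *)

Lemma search_exists (P : nat -> nat) :
  exists h : nat -> nat, forall n, h n = if P n =? 0 then n else h (S n).
Proof.
  (* The least zero from [n] on, or 0 if there is none. The default respects the equation: without a
     zero from [n] on, both sides are 0. *)
  set (R := fun n k => (n <= k /\ P k = 0 /\ forall i, n <= i < k -> P i <> 0) \/
                       (k = 0 /\ forall i, n <= i -> P i <> 0)).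
  assert (Rtot : forall n, exists k, R n k).
  { intros n. destruct (classic (exists d, P (n + d) = 0)) as [H|H].
    - destruct (dec_inh_nat_subset_has_unique_least_element (fun d => P (n + d) = 0))
        as (d & [Hd Hmin] & _); [intros; apply classic | exact H|].
      exists (n + d). left. repeat split; [lia|exact Hd|]. intros i Hi Pi.
      specialize (Hmin (i - n)). replace (n + (i - n)) with i in Hmin by lia. specialize (Hmin Pi). lia.
    - exists 0. right. split; [reflexivity|]. intros i Hi Pi. apply H. exists (i - n).
      now replace (n + (i - n)) with i by lia. }
  assert (Rfun : forall n k k', R n k -> R n k' -> k = k').
  { intros n k k' [(H1 & H2 & H3)|(H1 & H2)] [(H1' & H2' & H3')|(H1' & H2')].
    - destruct (lt_eq_lt_dec k k') as [[H|H]|H]; [|exact H|].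
      + now destruct (H3' k).
      + now destruct (H3 k').
    - now destruct (H2' k).
    - now destruct (H2 k').
    - congruence. }
  exists (fun n => epsilon (inhabits 0) (R n)). intros n.
  pose proof (epsilon_spec (inhabits 0) (R n) (Rtot n)) as Hn.
  pose proof (epsilon_spec (inhabits 0) (R (S n)) (Rtot (S n))) as HSn.
  destruct (Nat.eqb_spec (P n) 0) as [H0|H0].
  - apply (Rfun n); [exact Hn|]. left. repeat split; [lia|exact H0|lia].
  - apply (Rfun (S n)); [|exact HSn]. destruct Hn as [(H1 & H2 & H3)|(H1 & H2)].
    + left. assert (n <> epsilon (inhabits 0) (R n)) by congruence.
      repeat split; [lia|exact H2|]. intros i Hi. apply H3. lia.
    + right. split; [exact H1|]. intros i Hi. apply H2. lia.
Qed.

Definition search (P : nat -> nat) : nat -> nat :=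
  proj1_sig (constructive_indefinite_description _ (search_exists P)).

Lemma search_eq P n : search P n = if P n =? 0 then n else search P (S n).
Proof. exact (proj2_sig (constructive_indefinite_description _ (search_exists P)) n). Qed.

Fixpoint denote (m : nat) (t : ufun) (p : nat) : nat :=
  match t with
  | UId => p
  | USucc => S p
  | UPred => pred p
  | UZero => 0
  | UInput => m
  | UFst => pfst p
  | USnd => psnd p
  | UComp a b => denote m a (denote m b p)
  | UPair a b => pair (denote m a p) (denote m b p)
  | UIf c a b => if denote m c p =? 0 then denote m a p else denote m b p
  | UPrec f g =>
      nat_rect (fun _ => nat) (denote m f (psnd p))
        (fun n y => denote m g (pair n (pair y (psnd p)))) (pfst p)
  | USearch f => search (fun k => denote m f (pair k (psnd p))) (pfst p)
  end.

Lemma denote_prec_body m f g p : denote m (UPrec f g) p = denote m (prec_body f g) p.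
Proof.
  cbn [denote prec_body]. rewrite pfst_pair, psnd_pair. destruct (pfst p); reflexivity.
Qed.

Lemma denote_search_body m f p : denote m (USearch f) p = denote m (search_body f) p.
Proof.
  cbn [denote search_body]. rewrite search_eq, pair_eta, pfst_pair, psnd_pair. reflexivity.
Qed.

Lemma denote_eq_model m : eq_model (fun _ => True) nat (fun _ => True) 0 S (denote m).
Proof.
  constructor; intros; try reflexivity; try exact I; try discriminate.
  - apply pfst_pair.
  - apply psnd_pair.
  - cbn [denote]. match goal with H : _ = 0 |- _ => now rewrite H end.
  - cbn [denote]. match goal with H : _ <> 0 |- _ => now apply Nat.eqb_neq in H as -> end.
  - apply denote_prec_body.
  - apply denote_search_body.
Qed.

Fixpoint label (t : ufun) : nat :=
  match t with
  | UId => pair 0 (pair 0 0)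
  | USucc => pair 1 (pair 0 0)
  | UPred => pair 2 (pair 0 0)
  | UZero => pair 3 (pair 0 0)
  | UInput => pair 4 (pair 0 0)
  | UFst => pair 5 (pair 0 0)
  | USnd => pair 6 (pair 0 0)
  | UComp a b => pair 7 (pair (label a) (label b))
  | UPair a b => pair 8 (pair (label a) (label b))
  | UIf c a b => pair 9 (pair (label c) (pair (label a) (label b)))
  | UPrec f g => pair 10 (pair (label f) (label g))
  | USearch f => pair 11 (pair (label f) 0)
  end.

Lemma label_inj t : forall u, label t = label u -> t = u.
Proof.
  induction t; intros [] H; cbn [label] in H; apply pair_inj in H as [Htag H];
    try discriminate; repeat (apply pair_inj in H as [? H]); f_equal; auto.
Qed.

(** Off the range of [label] this is an unspecified term; the clauses that prescribe values name
    actual labels only. *)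
Definition unlabel (j : nat) : ufun := epsilon (inhabits UId) (fun t => label t = j).

Lemma unlabel_label t : unlabel (label t) = t.
Proof.
  apply label_inj. unfold unlabel.
  apply (epsilon_spec (inhabits UId) (fun u => label u = label t)). eauto.
Qed.

(** * Describing the equations at two points *)

Fixpoint sats Q {M} (e : nat -> M) (hs : list form) (P : Prop) : Prop :=
  match hs with [] => P | h :: hs' => sat Q e h -> sats Q e hs' P end.

Lemma sat_rule Q M (e : nat -> M) hs p : sat Q e (rule hs p) <-> sats Q e hs (sat Q e p).
Proof.
  unfold rule. rewrite sat_imp.
  induction hs as [|h hs IH]; cbn [conjs sat sats]; [tauto | rewrite <- IH; tauto].
Qed.

(* The functions [F 0], ..., [F 5] are successor, next label, label, base, value and
   auxiliary value: for an element [x] with label [j] and base [n], the value [F 4 x] is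
   the [j]-th unary function applied to [n], and [F 5 x] is an intermediate result of its
   computation, needed because a clause sees only two elements at a time. *)
Definition good {M} (e : nat -> M) (F : nat -> M -> M) (x x' : M) (env : nat -> M) : Prop :=
  env pt1 = x /\ env pt2 = x' /\
  (forall i, i < 6 -> env (fn1 i) = F i x) /\ (forall i, i < 6 -> env (fn2 i) = F i x') /\
  (forall j, env (cst j) = e (cst j)).

Definition has1 (t : ufun) : form := FEq (fn1 2) (cst (label t)).
Definition has2 (t : ufun) : form := FEq (fn2 2) (cst (label t)).
Definition same_base : form := FEq (fn1 3) (fn2 3).
Definition alias (t u : ufun) : list form * form :=
  ([has1 t; has2 u; same_base], FEq (fn1 4) (fn2 4)).

(** A composition needs three elements but a clause sees two: the first clause stores the inner
    value in [F 5], the second reads it back. A conditional stores its test likewise. The laws of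
    [UFst] and [USnd] are attached to the pairs. *)
Definition rules (t : ufun) : list (list form * form) :=
  match t with
  | UId => [([has1 t], FEq (fn1 4) (fn1 3))]
  | USucc => [([has1 t; FEq (fn1 3) pt2], FEq (fn1 4) (fn2 0))]
  | UPred => [([has1 t; FEq (fn1 3) (fn2 0)], FEq (fn1 4) pt2)]
  | UZero => [([has1 t], FEq (fn1 4) (cst 0))]
  | UInput | UFst | USnd => []
  | UComp a b =>
      [([has1 t; has2 b; same_base], FEq (fn1 5) (fn2 4));
       ([has1 t; has2 a; FEq (fn2 3) (fn1 5)], FEq (fn1 4) (fn2 4))]
  | UPair a b => [alias (UComp UFst t) a; alias (UComp USnd t) b]
  | UIf c a b =>
      [([has1 t; has2 c; same_base], FEq (fn1 5) (fn2 4));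
       ([has1 t; has2 a; same_base; FEq (fn1 5) (cst 0)], FEq (fn1 4) (fn2 4));
       ([has1 t; has2 b; same_base; FNeg (FEq (fn1 5) (cst 0))], FEq (fn1 4) (fn2 4))]
  | UPrec f g => [alias t (prec_body f g)]
  | USearch f => [alias t (search_body f)]
  end.

(** Numbers are the elements of label [cst 0] that are their own base. The clauses make all values
    and zero numbers, and keep zero from being a successor. *)
Definition base_rules : list (list form * form) :=
  [([FEq pt2 (fn1 4)], FAnd (FEq (fn2 2) (cst 0)) (FEq (fn2 3) pt2));
   ([FEq pt1 (cst 0)], FAnd (FEq (fn1 2) (cst 0)) (FEq (fn1 3) pt1));
   ([], FNeg (FEq (fn1 0) (cst 0)))].

(** Iterating [F 1] from a number, whose label is [cst 0], reaches an element of each needed label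
    over that base. *)
Definition step_rule (j : nat) : list form * form :=
  ([FEq pt2 (fn1 1); FEq (fn1 2) (cst j)],
   FAnd (FEq (fn2 2) (cst (S j))) (FEq (fn2 3) (fn1 3))).

Definition nonzero_rule (t : ufun) : list form * form :=
  ([has1 t], FNeg (FEq (fn1 4) (cst 0))).

(** The input numeral is left to [input_form], so the code of [body] can itself serve as the
    input. *)
Definition body (T : list ufun) (t : ufun) : form :=
  conjs (map (fun r => rule (fst r) (snd r))
    (base_rules ++ map step_rule (seq 0 (list_max (map label T))) ++ flat_map rules T
     ++ [nonzero_rule t])).

Definition input_form (n : nat) : form :=
  FAnd (chain n) (imp (has1 UInput) (FEq (fn1 4) (cst n))).

Lemma sat_chain Q M (e : nat -> M) n :
  sat Q e (chain n) <->
  forall i, i < n -> e pt1 = e (cst i) -> e (fn1 0) = e (cst (S i)).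
Proof.
  induction n as [|n IH]; cbn [chain].
  - split; [lia | reflexivity].
  - change (sat Q e (imp (FEq pt1 (cst n)) (FEq (fn1 0) (cst (S n)))) /\ sat Q e (chain n) <->
      forall i, i < S n -> e pt1 = e (cst i) -> e (fn1 0) = e (cst (S i))).
    rewrite sat_imp, IH. cbn [sat]. split.
    + intros [H1 H2] i Hi. destruct (Nat.eq_dec i n) as [->|]; [exact H1|apply H2; lia].
    + intros H. split; [apply H; lia | intros i Hi; apply H; lia].
Qed.

(* Turns a clause at two chosen points into a statement about [e], [F] and these points, eliminating
   the environment. *)
Tactic Notation "extract" constr(H) "as" ident(Hs) :=
  let env := fresh "env" in
  let g0 := fresh "at1" in let g1 := fresh "at2" in let g2 := fresh "fn_at1" in
  let g3 := fresh "fn_at2" in let g4 := fresh "at_cst" in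
  destruct H as (env & (g0 & g1 & g2 & g3 & g4) & Hs);
  cbn [sats sat has1 has2 same_base alias] in Hs;
  rewrite ?g0, ?g1, ?g4 in Hs; rewrite ?g2, ?g3 in Hs by lia; clear g0 g1 g2 g3 g4.

(** Each equation follows by reading its clauses at the labelled elements concerned. *)
Lemma body_sound Q M (e : nat -> M) F T t n :
  In USucc T -> dep_closed (fun u => In u T) -> 
  (forall x x', exists env, good e F x x' env /\ sat Q env (FAnd (body T t) (input_form n))) ->
  In t T -> In UInput T ->
  exists N z s G, eq_model (fun u => In u T) M N z s G /\
    (forall p, N p -> G UInput p = Nat.iter n s z) /\ (forall p, N p -> G t p <> z).
Proof.
  intros HSucc HT H Ht HInput.
  assert (Hr : forall hs q,
    In (hs, q) (base_rules ++ map step_rule (seq 0 (list_max (map label T))) ++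
                flat_map rules T ++ [nonzero_rule t]) ->
    forall x x', exists env, good e F x x' env /\ sats Q env hs (sat Q env q)).
  { intros hs q Hin x x'. destruct (H x x') as (env & Hg & [Hb _]). exists env. split; [exact Hg|].
    apply sat_rule. unfold body in Hb. rewrite sat_conjs in Hb. apply Hb.
    apply (in_map (fun r => rule (fst r) (snd r)) _ (hs, q)), Hin. }
  assert (Hbase : forall hs q, In (hs, q) base_rules ->
    forall x x', exists env, good e F x x' env /\ sats Q env hs (sat Q env q))
    by (intros; apply Hr, in_or_app; auto).
  assert (Hrules : forall u hs q, In u T -> In (hs, q) (rules u) ->
    forall x x', exists env, good e F x x' env /\ sats Q env hs (sat Q env q)).
  { intros u hs q Hu Hq. apply Hr. rewrite !in_app_iff. right. right. left.
    apply in_flat_map. eauto. }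
  set (z := e (cst 0)). set (s := F 0).
  (* [el j p] is the element of label j over the number p, and [F 4] evaluates it. *)
  set (N := fun p => F 2 p = z /\ F 3 p = p).
  set (el := fun j p => Nat.iter j (F 1) p).
  set (G := fun u p => F 4 (el (label u) p)).
  assert (HV : forall x, N (F 4 x)).
  { intros x. extract (Hbase _ _ (or_introl eq_refl) x (F 4 x)) as Hs. apply Hs. reflexivity. }
  assert (Hz : N z).
  { extract (Hbase _ _ (or_intror (or_introl eq_refl)) z z) as Hs. apply Hs. reflexivity. }
  assert (Hel : forall j p, j <= list_max (map label T) -> N p ->
    F 2 (el j p) = e (cst j) /\ F 3 (el j p) = p).
  { induction j as [|j IH]; intros p Hj Np; [exact Np|]. destruct (IH p) as [H1 H2]; [lia|exact Np|].
    assert (Hin : In (step_rule j) (base_rules ++ map step_rule (seq 0 (list_max (map label T))) ++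
                flat_map rules T ++ [nonzero_rule t])).
    { rewrite !in_app_iff. right. left. apply in_map, in_seq. lia. }
    change (el (S j) p) with (F 1 (el j p)).
    extract (Hr _ _ Hin (el j p) (F 1 (el j p))) as Hs.
    destruct Hs as [H3 H4]; auto. split; congruence. }
  assert (HelT : forall u p, In u T -> N p ->
    F 2 (el (label u) p) = e (cst (label u)) /\ F 3 (el (label u) p) = p).
  { intros u p Hu. apply Hel.
    pose proof (proj1 (list_max_le (map label T) _) (le_n _)) as Hm.
    rewrite Forall_forall in Hm. apply Hm, in_map, Hu. }
  assert (Halias : forall u a b p, In u T -> In (alias a b) (rules u) -> In a T -> In b T -> N p ->
    G a p = G b p).
  { intros u a b p Hu Hab Ha Hb Np. destruct (HelT a p), (HelT b p); auto.
    extract (Hrules _ _ _ Hu Hab (el (label a) p) (el (label b) p)) as Hs. apply Hs; congruence. }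
  assert (HUSucc : forall p, N p -> G USucc p = s p).
  { intros p Np. destruct (HelT USucc p); auto.
    extract (Hrules _ _ _ HSucc (or_introl eq_refl) (el (label USucc) p) p) as Hs.
    apply Hs; assumption. }
  assert (Hs : forall p, N p -> N (s p)) by (intros p Np; rewrite <- HUSucc by exact Np; apply HV).
  assert (HUComp : forall a b p, In (UComp a b) T -> N p -> G (UComp a b) p = G a (G b p)).
  { intros a b p Hab Np.
    assert (Ha : In a T) by (apply (HT _ _ Hab); cbn; auto).
    assert (Hb : In b T) by (apply (HT _ _ Hab); cbn; auto).
    destruct (HelT (UComp a b) p Hab Np), (HelT b p Hb Np), (HelT a (G b p) Ha (HV _)).
    extract (Hrules _ _ _ Hab (or_introl eq_refl) (el (label (UComp a b)) p) (el (label b) p)) as E1.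
    extract (Hrules _ _ _ Hab (or_intror (or_introl eq_refl))
               (el (label (UComp a b)) p) (el (label a) (G b p))) as E2.
    apply E2; [assumption..|]. rewrite E1 by congruence. assumption. }
  exists N, z, s, G. split; [constructor|split].
  - exact Hz.
  - exact Hs.
  - intros u p _ _. apply HV.
  - intros p. extract (Hbase _ _ (or_intror (or_intror (or_introl eq_refl))) p p) as E1. exact E1.
  - intros p Hu Np. destruct (HelT UId p) as [H1 H2]; auto.
    extract (Hrules _ _ _ Hu (or_introl eq_refl) (el (label UId) p) p) as H3.
    unfold G. rewrite H3; assumption.
  - auto.
  - intros p Hu Np. destruct (HelT UPred (s p)) as [H1 H2]; auto.
    extract (Hrules _ _ _ Hu (or_introl eq_refl) (el (label UPred) (s p)) p) as H3.
    apply H3; assumption.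
  - intros p Hu Np. destruct (HelT UZero p) as [H1 H2]; auto.
    extract (Hrules _ _ _ Hu (or_introl eq_refl) (el (label UZero) p) p) as H3.
    apply H3; assumption.
  - exact HUComp.
  - intros a b p Hu Np. assert (Hc : In (UComp UFst (UPair a b)) T) by (apply (HT _ _ Hu); cbn; auto).
    rewrite <- HUComp by auto. apply (Halias (UPair a b)); cbn; auto. apply (HT _ _ Hu); cbn; auto.
  - intros a b p Hu Np. assert (Hc : In (UComp USnd (UPair a b)) T) by (apply (HT _ _ Hu); cbn; auto).
    rewrite <- HUComp by auto. apply (Halias (UPair a b)); cbn; auto. apply (HT _ _ Hu); cbn; auto.
  - intros c a b p Hu Np Hc0.
    assert (Ha : In a T) by (apply (HT _ _ Hu); cbn; auto).
    assert (Hc : In c T) by (apply (HT _ _ Hu); cbn; auto).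
    destruct (HelT (UIf c a b) p), (HelT c p), (HelT a p); auto.
    extract (Hrules _ _ _ Hu (or_introl eq_refl) (el (label (UIf c a b)) p) (el (label c) p)) as E1.
    extract (Hrules _ _ _ Hu (or_intror (or_introl eq_refl))
               (el (label (UIf c a b)) p) (el (label a) p)) as E2.
    apply E2; try congruence. rewrite E1 by congruence. exact Hc0.
  - intros c a b p Hu Np Hc0.
    assert (Hb : In b T) by (apply (HT _ _ Hu); cbn; auto).
    assert (Hc : In c T) by (apply (HT _ _ Hu); cbn; auto).
    destruct (HelT (UIf c a b) p), (HelT c p), (HelT b p); auto.
    extract (Hrules _ _ _ Hu (or_introl eq_refl) (el (label (UIf c a b)) p) (el (label c) p)) as E1.
    extract (Hrules _ _ _ Hu (or_intror (or_intror (or_introl eq_refl)))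
               (el (label (UIf c a b)) p) (el (label b) p)) as E2.
    apply E2; try congruence. rewrite E1 by congruence. exact Hc0.
  - intros f g p Hu Np. apply (Halias (UPrec f g)); cbn [rules In]; auto.
    apply (HT _ _ Hu). now left.
  - intros f p Hu Np. apply (Halias (USearch f)); cbn [rules In]; auto.
    apply (HT _ _ Hu). now left.
  (* The chain is climbed by taking [cst i] as the first point. *)
  - assert (Hch : forall i, i <= n -> Nat.iter i s z = e (cst i)).
    { induction i as [|i IH]; intros Hi; [reflexivity|].
      change (Nat.iter (S i) s z) with (s (Nat.iter i s z)). rewrite IH by lia.
      destruct (H (e (cst i)) z) as (env & (g0 & _ & g1 & _ & g2) & _ & Hc & _).
      rewrite sat_chain in Hc. specialize (Hc i ltac:(lia)). rewrite g0, !g2, g1 in Hc by lia.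
      apply Hc. reflexivity. }
    intros p Np. rewrite Hch by lia. destruct (HelT UInput p) as [H1 H2]; auto.
    destruct (H (el (label UInput) p) z) as (env & (_ & _ & g1 & _ & g2) & _ & _ & Hi).
    rewrite sat_imp in Hi. cbn [sat has1] in Hi. rewrite !g2, !g1 in Hi by lia. apply Hi, H1.
  - intros p Np. destruct (HelT t p) as [H1 H2]; auto.
    assert (Hin : In (nonzero_rule t) (base_rules ++ map step_rule (seq 0 (list_max (map label T))) ++
                flat_map rules T ++ [nonzero_rule t])) by (rewrite !in_app_iff; cbn; auto).
    extract (Hr _ _ Hin (el (label t) p) z) as H3. apply H3, H1.
Qed.

Lemma wf_body Q T t : wf Q (body T t).
Proof.
  unfold body. apply wf_conjs. intros p Hp. apply in_map_iff in Hp as (r & <- & Hr).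
  rewrite !in_app_iff in Hr. destruct Hr as [Hr|[Hr|[Hr|[<-|[]]]]].
  - cbn [base_rules In] in Hr. intuition subst; cbn; tauto.
  - apply in_map_iff in Hr as (j & <- & _). cbn. tauto.
  - apply in_flat_map in Hr as (u & _ & Hu).
    destruct u; cbn [rules alias In] in Hu; intuition subst; cbn; tauto.
  - cbn. tauto.
Qed.

Lemma wf_input_form Q n : wf Q (input_form n).
Proof.
  split; [|cbn; tauto]. induction n as [|n IH]; [exact I|]. split; [cbn; tauto | exact IH].
Qed.

Definition auxiliary (m : nat) (t : ufun) : nat -> nat :=
  match t with
  | UComp _ b => denote m b
  | UIf c _ _ => denote m c
  | _ => fun _ => 0
  end.

(* The element [(j, n)] stands for the function labelled [j] at the argument [n]; the number
   [n] is [(0, n)], whether it serves as an argument, a value or the name of a label. *)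
Definition std_env (v : nat) : nat * nat := (0, v - 24).

Definition std_fun (m : nat) (i : nat) (x : nat * nat) : nat * nat :=
  let (j, n) := x in
  match i with
  | 0 => (j, S n)
  | 1 => (S j, n)
  | 2 => (0, j)
  | 3 => (0, n)
  | 4 => (0, denote m (unlabel j) n)
  | _ => (0, auxiliary m (unlabel j) n)
  end.

Lemma std_env_cst j : std_env (cst j) = (0, j).
Proof. unfold std_env, cst. f_equal. lia. Qed.

#[local] Opaque label.

Ltac std at1 at2 fn_at1 fn_at2 at_cst' :=
  rewrite ?at1, ?at2, ?at_cst'; rewrite ?fn_at1, ?fn_at2 by lia; cbn [std_fun].

(** The label premises of a clause identify the labels of the two elements, [unlabel] recovers the
    terms, and an equation for [denote] remains. *)
Lemma body_complete Q m T t x x' env :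
  (forall n, denote m t n <> 0) -> good std_env (std_fun m) x x' env ->
  sat Q env (FAnd (body T t) (input_form m)).
Proof.
  intros Ht (at1 & at2 & fn_at1 & fn_at2 & at_cst).
  assert (at_cst' : forall j, env (cst j) = (0, j))
    by (intros j; rewrite at_cst; apply std_env_cst).
  destruct x as [j n], x' as [j' n'].
  split; [|split].
  - unfold body. rewrite sat_conjs. intros p Hp. apply in_map_iff in Hp as ([hs q] & <- & Hr).
    cbn [fst snd]. rewrite sat_rule.
    rewrite !in_app_iff in Hr. destruct Hr as [Hr|[Hr|[Hr|[Hr|[]]]]].
    + cbn [base_rules In] in Hr.
      repeat (destruct Hr as [Hr|Hr]; [injection Hr as <- <-; cbn [sats sat]; std at1 at2 fn_at1 fn_at2 at_cst'|]).
      * intros [= -> ->]. auto.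
      * intros [= -> ->]. auto.
      * congruence.
      * destruct Hr.
    + apply in_map_iff in Hr as (i & [= <- <-] & _). cbn [sats sat].
      std at1 at2 fn_at1 fn_at2 at_cst'. intros [= -> ->] [= ->]. auto.
    + apply in_flat_map in Hr as (u & _ & Hu).
      destruct u; cbn [rules alias In] in Hu;
      repeat (destruct Hu as [Hu|Hu];
        [injection Hu as <- <-; cbn [sats sat has1 has2 same_base];
         std at1 at2 fn_at1 fn_at2 at_cst'|]); try destruct Hu;
      intros; repeat match goal with
      | H : (_, _) = (_, _) |- _ => injection H; clear H; intros; subst
      | H : (_, _) <> (_, _) |- _ => rewrite pair_equal_spec in H
      end; rewrite ?unlabel_label in *; cbn [denote auxiliary] in *; try reflexivity.
      * now rewrite pfst_pair.
      * now rewrite psnd_pair.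
      * now match goal with H : _ = 0 |- _ => rewrite H end.
      * destruct (Nat.eqb_spec (denote m u1 n') 0); [tauto|reflexivity].
      * f_equal. apply denote_prec_body.
      * f_equal. apply denote_search_body.
    + injection Hr as <- <-. cbn [sats sat has1]. std at1 at2 fn_at1 fn_at2 at_cst'.
      intros [= ->] [=]. rewrite unlabel_label in *. now destruct (Ht n).
  - apply sat_chain. intros i _. std at1 at2 fn_at1 fn_at2 at_cst'. intros [= -> ->]. reflexivity.
  - apply sat_imp. cbn [sat has1]. std at1 at2 fn_at1 fn_at2 at_cst'.
    intros [= ->]. now rewrite unlabel_label.
Qed.

(** * The two-point form in the two Henkin prefixes *)

(** [copies] makes the existentials for the second point the same functions as those for the first;
    [guard] discards assignments that do not encode two points. Introduction quantifies over all
    environments since [good] leaves some prefix variables open. *)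
Definition two_point (Q : henkin) (xs ys : list nat) (copies guard : form) : Prop :=
  wf Q (FQ xs ys (FAnd copies guard)) /\
  (forall M (e : nat -> M) p, sat Q e (FQ xs ys (FAnd copies (imp guard p))) ->
     exists F, forall x x', exists env, good e F x x' env /\ sat Q env p) /\
  (forall M (e : nat -> M) F p, (forall x x' env, good e F x x' env -> sat Q env p) ->
     sat Q e (FQ xs ys (FAnd copies (imp guard p)))).

Lemma sat_conjs_seq Q M (e : nat -> M) (g : nat -> form) n :
  sat Q e (conjs (map g (seq 0 n))) <-> forall i, i < n -> sat Q e (g i).
Proof.
  rewrite sat_conjs. split.
  - intros H i Hi. apply H, in_map, in_seq. lia.
  - intros H p Hp. apply in_map_iff in Hp as (i & <- & Hi). apply H. apply in_seq in Hi. lia.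
Qed.

(** Slots [i] and [6 + i] are compared at equal arguments. *)
Definition H_copies : form :=
  conjs (map (fun i => imp (FEq i (6 + i)) (FEq (fn1 i) (fn2 i))) (seq 0 6)).
(** The first six universals must agree, and so must the last six, so each half of the slots is read
    at a single point. *)
Definition H_guard : form :=
  conjs (map (fun i => FAnd (FEq 0 i) (FEq 6 (6 + i))) (seq 0 6)).

Lemma updl_H M (e a g : nat -> M) :
  let env := updl (updl e (seq 0 12) a) (seq 12 12) g in
  (forall i, i < 12 -> env i = a i) /\ (forall i, i < 12 -> env (12 + i) = g i) /\
  (forall j, env (cst j) = e (cst j)).
Proof.
  split; [|split; [|reflexivity]];
    intros i Hi; do 12 (destruct i as [|i]; [reflexivity|]); lia.
Qed.

(* Slots 0-5 of [H_12] hold the six functions at the first point, slots 6-11 hold them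
   at the second point. *)
Lemma two_point_Hq : two_point (Hq 12) (seq 0 12) (seq 12 12) H_copies H_guard.
Proof.
  split; [|split].
  - split; [reflexivity|split; [reflexivity|split]].
    + apply (seq_NoDup 24 0).
    + cbn. tauto.
  - intros M e p [f [Hf H]].
    assert (Hloc : forall i (a a' : nat -> M), a i = a' i -> f i a = f i a').
    { intros i a a' Ha. apply Hf. intros j _ Hj. apply Nat.eqb_eq in Hj. now subst. }
    exists (fun i x => f i (fun _ => x)). intros x x'.
    assert (Hcopy : forall i, i < 6 -> f (6 + i) (fun _ => x') = f i (fun _ => x')).
    { intros i Hi. destruct (H (fun _ => x')) as [Hc _]. unfold H_copies in Hc.
      rewrite sat_conjs_seq in Hc. specialize (Hc i Hi). rewrite sat_imp in Hc. cbn [sat] in Hc.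
      change (fn2 i) with (12 + (6 + i)) in Hc. change (fn1 i) with (12 + i) in Hc.
      destruct (updl_H M e (fun _ => x') (fun i => f i (fun _ => x'))) as (Ex & Ey & _).
      rewrite !Ex, !Ey in Hc by lia. symmetry. now apply Hc. }
    (* This assignment passes the guard and encodes the points [x] and [x']. *)
    set (a := fun i => if i <? 6 then x else x').
    destruct (H a) as [_ Hp]. rewrite sat_imp in Hp.
    destruct (updl_H M e a (fun i => f i a)) as (Ex & Ey & Ec).
    eexists. split; [|apply Hp].
    + split; [exact (Ex 0 ltac:(lia))|split; [exact (Ex 6 ltac:(lia))|split; [|split; [|exact Ec]]]];
        intros i Hi.
      * unfold fn1. rewrite Ey by lia. apply Hloc. unfold a.
        now rewrite (proj2 (Nat.ltb_lt i 6) Hi).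
      * change (fn2 i) with (12 + (6 + i)). rewrite Ey, <- Hcopy by lia. apply Hloc. reflexivity.
    + apply sat_conjs_seq. intros i Hi. cbn [sat]. rewrite !Ex by lia. unfold a.
      now rewrite (proj2 (Nat.ltb_lt i 6) Hi).
  - intros M e F p H.
    (* Indices from 12 on belong to no existential and depend on no universal, so a constant value
       is chosen there. *)
    exists (fun i a => if i <? 6 then F i (a i) else if i <? 12 then F (i - 6) (a i) else e 0).
    assert (F1 : forall i (a : nat -> M), i < 6 ->
      (if i <? 6 then F i (a i) else if i <? 12 then F (i - 6) (a i) else e 0) = F i (a i)).
    { intros i a Hi. now rewrite (proj2 (Nat.ltb_lt i 6) Hi). }
    assert (F2 : forall i (a : nat -> M), i < 6 ->
      (if 6 + i <? 6 then F (6 + i) (a (6 + i))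
       else if 6 + i <? 12 then F (6 + i - 6) (a (6 + i)) else e 0) = F i (a (6 + i))).
    { intros i a Hi. rewrite (proj2 (Nat.ltb_ge (6 + i) 6)), (proj2 (Nat.ltb_lt (6 + i) 12)) by lia.
      now replace (6 + i - 6) with i by lia. }
    split.
    + intros i a a' Ha. assert (Hi : i < 12 -> a i = a' i) by (intros; apply Ha, Nat.eqb_refl; auto).
      destruct (Nat.ltb_spec i 6), (Nat.ltb_spec i 12); try reflexivity; rewrite Hi by lia; reflexivity.
    + intros a. set (g := fun i => _).
      destruct (updl_H M e a g) as (Ex & Ey & Ec). split.
      * apply sat_conjs_seq. intros i Hi. apply sat_imp. cbn [sat].
        change (fn2 i) with (12 + (6 + i)). change (fn1 i) with (12 + i).
        rewrite !Ex, !Ey by lia. unfold g. rewrite F1, F2 by lia. congruence.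
      * apply sat_imp. intros Hg. unfold H_guard in Hg. rewrite sat_conjs_seq in Hg.
        cbn [sat] in Hg. apply H with (x := a 0) (x' := a 6).
        split; [exact (Ex 0 ltac:(lia))|split; [exact (Ex 6 ltac:(lia))|split; [|split; [|exact Ec]]]];
          intros i Hi; specialize (Hg i Hi); rewrite !Ex in Hg by lia.
        -- unfold fn1. rewrite Ey by lia. unfold g. rewrite F1 by lia. f_equal. symmetry. apply Hg.
        -- change (fn2 i) with (12 + (6 + i)). rewrite Ey by lia. unfold g. rewrite F2 by lia.
           f_equal. symmetry. apply Hg.
Qed.

(* The existential [i < 6] sits at variable [fn1 i] and the existential [10 + i] at [fn2 i];
   the other existentials are idle. *)
Definition E_universals : list nat := [pt1; pt2].
Definition E_existentials : list nat :=
  [12; 13; 14; 15; 16; 17; 1; 2; 3; 4; 18; 19; 20; 21; 22; 23; 5; 7; 8; 9].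
Definition E_copies : form :=
  conjs (map (fun i => imp (FEq pt1 pt2) (FEq (fn1 i) (fn2 i))) (seq 0 6)).

Lemma updl_E M (e a g : nat -> M) :
  let env := updl (updl e E_universals a) E_existentials g in
  env pt1 = a 0 /\ env pt2 = a 1 /\
  (forall i, i < 6 -> env (fn1 i) = g i) /\ (forall i, i < 6 -> env (fn2 i) = g (10 + i)) /\
  (forall j, env (cst j) = e (cst j)).
Proof.
  split; [reflexivity|split; [reflexivity|split; [|split; [|reflexivity]]]];
    intros i Hi; do 6 (destruct i as [|i]; [reflexivity|]); lia.
Qed.

(** The two universals are the two points themselves, so a trivial guard suffices. *)
Lemma two_point_Eq : two_point (Eq_ 10) E_universals E_existentials E_copies (FEq 0 0).
Proof.
  split; [|split].
  - split; [reflexivity|split; [reflexivity|split]].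
    + unfold E_universals, E_existentials, pt1, pt2. cbn [app].
      repeat constructor; cbn [In]; lia.
    + cbn. tauto.
  - intros M e p [f [Hf H]].
    assert (Hloc1 : forall i (a a' : nat -> M), i < 10 -> a 0 = a' 0 -> f i a = f i a').
    { intros i a a' Hi Ha. apply Hf. intros j _. cbn [hD Eq_].
      rewrite (proj2 (Nat.ltb_lt i 10) Hi). intros Hj%Nat.eqb_eq. now subst. }
    assert (Hloc2 : forall i (a a' : nat -> M), 10 <= i -> a 1 = a' 1 -> f i a = f i a').
    { intros i a a' Hi Ha. apply Hf. intros j _. cbn [hD Eq_].
      rewrite (proj2 (Nat.ltb_ge i 10) Hi). intros Hj%Nat.eqb_eq. now subst. }
    exists (fun i x => f i (fun _ => x)). intros x x'.
    assert (Hcopy : forall i, i < 6 -> f (10 + i) (fun _ => x') = f i (fun _ => x')).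
    { intros i Hi. destruct (H (fun _ => x')) as [Hc _]. unfold E_copies in Hc.
      rewrite sat_conjs_seq in Hc. specialize (Hc i Hi). rewrite sat_imp in Hc. cbn [sat] in Hc.
      destruct (updl_E M e (fun _ => x') (fun i => f i (fun _ => x'))) as (E1 & E2 & E3 & E4 & _).
      rewrite E1, E2, E3, E4 in Hc by lia. symmetry. now apply Hc. }
    set (a := fun i => if i =? 0 then x else x').
    destruct (H a) as [_ Hp]. rewrite sat_imp in Hp.
    destruct (updl_E M e a (fun i => f i a)) as (E1 & E2 & E3 & E4 & E5).
    eexists. split; [|apply Hp; reflexivity].
    split; [exact E1|split; [exact E2|split; [|split; [|exact E5]]]]; intros i Hi.
    + rewrite E3 by exact Hi. apply Hloc1; [lia|reflexivity].
    + rewrite E4, <- Hcopy by exact Hi. apply Hloc2; [lia|reflexivity].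
  - intros M e F p H.
    exists (fun i a => if i <? 10 then F i (a 0) else F (i - 10) (a 1)).
    split.
    + intros i a a' Ha. cbn [hA hD Eq_] in Ha. revert Ha.
      destruct (i <? 10); intros Ha; [rewrite (Ha 0) | rewrite (Ha 1)]; auto.
    + intros a. set (g := fun i => _).
      assert (G1 : forall i, i < 6 -> g i = F i (a 0)).
      { intros i Hi. unfold g. now rewrite (proj2 (Nat.ltb_lt i 10)) by lia. }
      assert (G2 : forall i, i < 6 -> g (10 + i) = F i (a 1)).
      { intros i Hi. unfold g. rewrite (proj2 (Nat.ltb_ge (10 + i) 10)) by lia.
        now replace (10 + i - 10) with i by lia. }
      destruct (updl_E M e a g) as (E1 & E2 & E3 & E4 & E5). split.
      * apply sat_conjs_seq. intros i Hi. apply sat_imp. cbn [sat].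
        rewrite E1, E2, E3, E4, G1, G2 by exact Hi. congruence.
      * apply sat_imp. intros _. apply H with (x := a 0) (x' := a 1).
        split; [exact E1|split; [exact E2|split; [|split; [|exact E5]]]]; intros i Hi.
        -- rewrite E3 by exact Hi. auto.
        -- rewrite E4 by exact Hi. auto.
Qed.

(** * Diagonalization *)

(** For a decider [D], the sentence [diag B] asserts that the answer of [D] on [diag B] is not 0,
    that is, that [D] does not call it satisfiable. *)
Lemma satisfiable_not_recursive Q xs ys copies guard :
  two_point Q xs ys copies guard -> ~ recursive_on (sentence Q) (satisfiable Q).
Proof.
  intros ((Hxs & Hys & Hnd & Hwc & Hwg) & Helim & Hintro) [D HD].
  set (diag := fun B => close (FQ xs ys
    (FAnd copies (imp guard (FAnd B (input_form (code B))))))).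
  assert (Hdiag : codable diag).
  { apply codable_close, codable_FQ, codable_FAnd; [apply codable_const|].
    apply codable_FNeg, codable_FAnd; [apply codable_const|].
    apply codable_FNeg, codable_FAnd; [apply codable_id|].
    apply codable_FAnd; [apply codable_chain|].
    apply codable_FNeg, codable_FAnd; [apply codable_const|].
    apply codable_FNeg, codable_eq_const. }
  destruct Hdiag as (h & [r Hr] & Hh).
  set (P := RComp D [r]).
  (* The input numeral is wrapped as a tuple with one entry. *)
  set (t := UComp (compile P) (UPair UInput UZero)).
  destruct (finite_dep_closure t) as (T0 & Ht & HT0).
  (* The clause of [USucc] exhibits successors as values, which makes the numbers closed under
     successor. *)
  set (T := [USucc] ++ T0).
  assert (HT : dep_closed (fun u => In u T)).
  { apply dep_closed_extend; [repeat constructor | exact HT0]. }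
  assert (HtT : In t T) by (right; exact Ht).
  set (B := body T t). set (n := code B).
  assert (HP : forall y, eval D [code (diag B)] y -> eval P [n] y).
  { intros y Hy. econstructor; [|exact Hy]. repeat constructor. rewrite <- Hh.
    apply Hr. reflexivity. }
  (* Applied twice: to an arbitrary model of the sentence and to the standard solution. *)
  assert (Hcorrect : forall S M N z s G, eq_model S M N z s G -> dep_closed S -> S t ->
    (forall p, N p -> G UInput p = Nat.iter n s z) ->
    forall y, eval P [n] y -> forall p, N p -> G t p = Nat.iter y s z).
  { intros S M N z s G E HS St Hin y Hy p Np. unfold t in *.
    assert (SP : S (UPair UInput UZero)) by (apply (HS _ _ St); cbn; auto).
    rewrite (em_UComp _ _ _ _ _ _ E) by auto.
    apply (compile_correct S M N z s G E HS P [n] y Hy).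
    - apply (HS _ _ St); cbn; auto.
    - apply (em_app _ _ _ _ _ _ E); auto.
    - cbn [represents]. rewrite (em_UFst _ _ _ _ _ _ E) by auto. auto. }
  assert (Hsent : sentence Q (diag B)).
  { apply sentence_close. split; [exact Hxs|split; [exact Hys|split; [exact Hnd|]]].
    split; [exact Hwc|]. split; [exact Hwg|]. split; [apply wf_body | apply wf_input_form]. }
  destruct (HD (diag B) Hsent) as [Hyes Hno].
  assert (Hunsat : ~ satisfiable Q (diag B)).
  { intros Hsat. pose proof (HP 0 (Hyes Hsat)) as H0.
    destruct Hsat as (M & _ & e & He). apply sat_exs_elim in He as [e' He'].
    apply Helim in He' as [F HF].
    destruct (body_sound Q M e' F T t n) as (N & z & s & G & E & HG & Hne);
      [now left | exact HT | exact HF | exact HtT | |].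
    - right. apply (HT0 (UPair UInput UZero)); [|cbn; auto]. apply (HT0 _ _ Ht). cbn. auto.
    - apply (Hne z (em_zero _ _ _ _ _ _ E)).
      apply (Hcorrect _ _ _ _ _ _ E HT HtT HG 0 H0 z (em_zero _ _ _ _ _ _ E)). }
  (* Being unsatisfiable, the sentence gets the answer 1; hence [t] has the value 1 everywhere in
     the standard solution, which satisfies the sentence after all. *)
  apply Hunsat. exists (nat * nat)%type, (0, 0), std_env. apply sat_exs_intro, Hintro with (F := std_fun n).
  intros x x' env Hgood. apply body_complete with (m := n) (x := x) (x' := x'); [|exact Hgood].
  intros p. rewrite (Hcorrect _ _ _ _ _ _ (denote_eq_model n)) with (y := 1); auto; try exact I.
  - intros u w _ _. exact I.
  - intros q _. cbn [denote]. clear. induction n as [|k IH]; [reflexivity|].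
    rewrite Nat.iter_succ. now f_equal.
Qed.

(** A sentence is satisfiable iff its negation is not valid, so the decider for validity is run on
    the negation and its answers 0 and 1 are exchanged. *)
Lemma satisfiable_recursive_of_valid Q :
  recursive_on (sentence Q) (valid Q) -> recursive_on (sentence Q) (satisfiable Q).
Proof.
  intros [D HD].
  assert (Hflip : computable 1 (fun v => nat_rect (fun _ => nat) 1 (fun _ _ => 0) (hd 0 v))).
  { apply (computable_prec 0 (fun _ => 1) (fun _ => 0)); apply computable_const. }
  destruct Hflip as [flip Hflip]. destruct (codable_FNeg _ codable_id) as (h & [r Hr] & Hh).
  exists (RComp flip [RComp D [r]]). intros p [Hwf Hfree].
  destruct (HD (FNeg p)) as [Hyes Hno]; [split; [exact Hwf|exact Hfree]|].
  assert (Heval : forall y, eval D [code (FNeg p)] y ->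
    eval (RComp flip [RComp D [r]]) [code p] (nat_rect (fun _ => nat) 1 (fun _ _ => 0) y)).
  { intros y Hy. econstructor; [|apply (Hflip [y]); reflexivity]. repeat constructor.
    econstructor; [|exact Hy]. repeat constructor. rewrite <- Hh. apply Hr. reflexivity. }
  split; intros H.
  - apply (Heval 1), Hno. intros Hv. destruct H as (M & m & e & He). exact (Hv M m e He).
  - apply (Heval 0), Hyes. intros M m e He. apply H. exists M, m, e. exact He.
Qed.

Theorem mainTheorem3 :
  ~ recursive_on (sentence (Hq 12)) (valid (Hq 12)) /\
  ~ recursive_on (sentence (Hq 12)) (satisfiable (Hq 12)) /\
  ~ recursive_on (sentence (Eq_ 10)) (valid (Eq_ 10)) /\
  ~ recursive_on (sentence (Eq_ 10)) (satisfiable (Eq_ 10)).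
Proof.
  pose proof (satisfiable_not_recursive _ _ _ _ _ two_point_Hq) as HH.
  pose proof (satisfiable_not_recursive _ _ _ _ _ two_point_Eq) as HE.
  repeat split; auto using satisfiable_recursive_of_valid.
Qed.
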